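(* Let $\delta\in(0,1)$. Assume that for each fixed state $\phi\in\mathcal S$ and weights $\mathbf w$ the map $\mathbf x\mapsto\mathrm{Upd}(\phi,\mathbf w,\mathbf x)$ is $L_h$-Lipschitz in $\mathbf x$ through the memory component $h$, i.e. $\mathbf x$ affects $\mathrm{Upd}(\phi,\mathbf w,\mathbf x)$ only through its memory component and $$\|h(\mathrm{Upd}(\phi,\mathbf w,\mathbf x))-h(\mathrm{Upd}(\phi,\mathbf w,\mathbf y))\|\le L_h\|\mathbf x-\mathbf y\|_2\qquad\text{for all }\mathbf x,\mathbf y\in\mathbb R^N.$$ Let $V:\mathcal S\to\mathbb R$ be bounded (measurable) and $L_V$-Lipschitz in the memory component, holding the exogenous context fixed: $|V(z,h)-V(z,h')|\le L_V\|h-h'\|$ for all states $(z,h),(z,h')$. Define $$\Delta_W:=\sup_{o\in\mathcal O}W_1\Big(P_{\mathrm{real}}(\cdot\mid\Phi(o)),\,P_{\mathrm{scen}}(\cdot\mid\Psi(o))\Big),$$ where $W_1$ is the 1-Wasserstein distance with ground metric $d(\mathbf x,\mathbf y)=\|\mathbf x-\mathbf y\|_2$ on $\mathbb R^N$. Then for any policy $\pi$ and any such $V$, $$\big\|T_{\mathrm{hyb}}^\pi V-T_{\mathrm{scen}}^\pi V\big\|_\infty\le\delta\,L_VL_h\,\Delta_W .$$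
   Context: Setting. States are pairs $\phi=(z,h)\in\mathcal S$, where $z$ is exogenous context and $h=h(\phi)$ is a memory component lying in a normed space $(\mathcal H,\|\cdot\|)$. $\mathcal A$ is a measurable action space; a policy $\pi$ assigns to each $\phi\in\mathcal S$ a probability measure $\pi(\cdot\mid\phi)$ on $\mathcal A$. A (measurable) map $\Pi$ sends an action $a$ to executed portfolio weights $\mathbf w=\Pi(a)\in\mathbb R^N$. The deterministic (measurable) update map $\mathrm{Upd}:(\phi,\mathbf w,\mathbf x)\mapsto\mathrm{Upd}(\phi,\mathbf w,\mathbf x)\in\mathcal S$ takes a state, weights and a return vector $\mathbf x\in\mathbb R^N$ to the next state. Information. $o\in\mathcal O$ denotes the information available at a decision time; $\phi=\Phi(o)$ and $\psi=\Psi(o)$ are the state and a descriptor constructed from the same $o$, with $\mathcal S=\Phi(\mathcal O)$. In the operators below, the descriptor $\psi$ paired with a state $\phi$ is $\psi=\Psi(o)$ for some (fixed, arbitrary) $o$ with $\Phi(o)=\phi$. $P_{\mathrm{real}}(\cdot\mid\phi)$ and $P_{\mathrm{scen}}(\cdot\mid\psi)$ are probability laws on $\mathbb R^N$ (the real-world and the scenario law of the next return vector), not depending on the action. $r(\phi,\mathbf w;\mathbf x)\in\mathbb R$ is the one-step reward, assumed integrable so that the expectations below make sense. Operators. With $a\sim\pi(\cdot\mid\phi)$, $\mathbf w=\Pi(a)$ and, given $a$, $\mathbf R\sim P_{\mathrm{scen}}(\cdot\mid\psi)$ and $\mathbf r\sim P_{\mathrm{real}}(\cdot\mid\phi)$,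 $$(T_{\mathrm{hyb}}^\pi V)(\phi):=\mathbb E\big[r(\phi,\mathbf w;\mathbf R)+\delta V(\mathrm{Upd}(\phi,\mathbf w,\mathbf r))\,\big|\,\phi\big],$$ $$(T_{\mathrm{scen}}^\pi V)(\phi):=\mathbb E\big[r(\phi,\mathbf w;\mathbf R)+\delta V(\mathrm{Upd}(\phi,\mathbf w,\mathbf R))\,\big|\,\phi\big].$$ $\|\cdot\|_\infty$ is the supremum norm over $\mathcal S$. *)

(* Defs.v *)
From HB Require Import structures.
From mathcomp Require Export all_boot all_order all_algebra.
From mathcomp Require Export all_classical all_reals all_analysis.
Export Order.TTheory GRing.Theory Num.Theory.
Export numFieldNormedType.Exports.

Set Implicit Arguments.
Unset Strict Implicit.
Unset Printing Implicit Defensive.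

Local Open Scope classical_set_scope.
Local Open Scope ring_scope.
Local Open Scope ereal_scope.

(* R^N is rendered as N.-tuple R: this is the type that carries the product
   (i.e. Borel) sigma-algebra in the library. *)
Definition dist2 (R : realType) (N : nat) (x y : N.-tuple R) : R :=
  Num.sqrt (\sum_(i < N) (tnth x i - tnth y i) ^+ 2)%R.

Definition coupling (R : realType) (d : measure_display) (T : measurableType d)
    (P Q : probability T R) : set (probability (T * T)%type R) :=
  [set g | forall X : set T, measurable X ->
     pushforward g fst X = P X /\ pushforward g snd X = Q X].

(* Extended-real valued: no finite first moment is required of P and Q. *)
Definition W1 (R : realType) (N : nat) (P Q : probability (N.-tuple R) R) :
    \bar R :=
  ereal_inf [set \int[g]_p (dist2 p.1 p.2)%:E | g in coupling P Q].

Definition DeltaW (R : realType) (N : nat) (O S D : Type)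
    (Phi : O -> S) (Psi : O -> D)
    (Preal : S -> probability (N.-tuple R) R)
    (Pscen : D -> probability (N.-tuple R) R) : \bar R :=
  ereal_sup (range (fun o : O => W1 (Preal (Phi o)) (Pscen (Psi o)))).

Definition sup_norm (R : realType) (S : Type) (f : S -> R) : \bar R :=
  ereal_sup (range (fun s : S => `|f s|%:E)).

(* J is a law of the triple ((a, R), r) with a ~ p, R ~ Q given a, and
   r ~ Q' given a.  The two return laws do not depend on the action, so the
   pairs (a, R) and (a, r) have product laws; the dependence between the
   returns R and r is left unconstrained. *)
Definition hyb_law (R : realType) (N : nat) (dA : measure_display)
    (A : measurableType dA) (p : probability A R)
    (Q Q' : probability (N.-tuple R) R)
    (J : probability (A * N.-tuple R * N.-tuple R)%type R) : Prop :=
  (forall X : set (A * N.-tuple R)%type, measurable X ->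
     pushforward J (fun t => (t.1.1, t.1.2)) X = (p \x Q) X) /\
  (forall X : set (A * N.-tuple R)%type, measurable X ->
     pushforward J (fun t => (t.1.1, t.2)) X = (p \x Q') X).

(* The law J s of the triple ((a, R), r) at the state s is constrained by
   hyb_law in the statement. *)
Definition Thyb (R : realType) (N : nat) (dA : measure_display)
    (A : measurableType dA) (S : Type)
    (Pi : A -> N.-tuple R) (Upd : S -> N.-tuple R -> N.-tuple R -> S)
    (r : S -> N.-tuple R -> N.-tuple R -> R) (delta : R)
    (J : S -> probability (A * N.-tuple R * N.-tuple R)%type R)
    (V : S -> R) (s : S) : R :=
  Rintegral (J s) setT (fun t =>
    r s (Pi t.1.1) t.1.2 + delta * V (Upd s (Pi t.1.1) t.2))%R.

(* sel s is the information o, with Phi o = s, whose descriptor is paired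
   with the state s. *)
Definition Tscen (R : realType) (N : nat) (dA : measure_display)
    (A : measurableType dA) (O S D : Type)
    (Psi : O -> D) (sel : S -> O) (Pscen : D -> probability (N.-tuple R) R)
    (Pi : A -> N.-tuple R) (Upd : S -> N.-tuple R -> N.-tuple R -> S)
    (r : S -> N.-tuple R -> N.-tuple R -> R) (delta : R)
    (pi : S -> probability A R) (V : S -> R) (s : S) : R :=
  Rintegral (pi s \x Pscen (Psi (sel s))) setT (fun t =>
    r s (Pi t.1) t.2 + delta * V (Upd s (Pi t.1) t.2))%R.

(* Main.v *)
(* Only the joint laws of (a, R) and of (a, r) enter the expectations, so the
   reward terms cancel and the gap is delta times the difference of the
   integrals of F (a, x) = V (Upd s (Pi a) x) against pi x P_real and
   pi x P_scen.  By Fubini it suffices to fix a, where F (a, -) is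
   (LV * Lh)-Lipschitz: writing both integrals over one coupling bounds their
   difference by LV * Lh times the transport cost (the easy half of
   Kantorovich-Rubinstein duality). *)
Require Import Defs.
From mathcomp Require Import measurable_realfun.

Set Implicit Arguments.
Unset Strict Implicit.
Unset Printing Implicit Defensive.

Local Open Scope classical_set_scope.
Local Open Scope ring_scope.

Lemma measurable_sqrt (R : realType) :
  measurable_fun [set: R] (@Num.sqrt R).
Proof. by apply: continuous_measurable_fun; exact: sqrt_continuous. Qed.

Lemma measurable_dist2 (R : realType) (N : nat) :
  measurable_fun setT (fun p : N.-tuple R * N.-tuple R => dist2 p.1 p.2).
Proof.
apply: measurableT_comp; first exact: measurable_sqrt.
apply: measurable_sum => i; apply: measurable_funX; apply: measurable_funB.
- by apply: measurableT_comp (measurable_tnth i) _; exact: measurable_fst.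
- by apply: measurableT_comp (measurable_tnth i) _; exact: measurable_snd.
Qed.

Section marginal.
Context (R : realType) d (T : measurableType d) d' (T' : measurableType d').
Context (g : {measure set T -> \bar R}) (P : {measure set T' -> \bar R}).
Context (phi : T -> T') (mphi : measurable_fun setT phi).
Context (gP : forall X, measurable X -> pushforward g phi X = P X).
Context (f : T' -> R) (intf : P.-integrable setT (EFin \o f)).

(** The change of variables for nonnegative functions, applied to the absolute value of [f], carries
    finiteness of the integral from [P] back to [g]. *)
Lemma integrable_marginal : g.-integrable setT (EFin \o (f \o phi)).
Proof.
case/integrableP: intf => mf foo; apply/integrableP; split.
  exact: measurableT_comp mf mphi.
rewrite -(ge0_integral_pushforward mphi g measurableT
  (f := fun y => `|(f y)%:E|%E)) //; last exact: measurableT_comp.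
by rewrite (eq_measure_integral P) // => X mX _; exact: gP.
Qed.

(** Serves two purposes: with [phi] a projection it unfolds both marginals of a coupling, and with
    [phi] a pair of coordinates it reads the laws of (a, R) and (a, r) off [J]. *)
Lemma Rintegral_marginal : \int[g]_t f (phi t) = \int[P]_t f t.
Proof.
congr fine; rewrite -(eq_measure_integral _ (fun X mX _ => gP mX)).
rewrite (integral_pushforward mphi) //.
- by case/integrableP: intf.
- exact: integrable_marginal.
Qed.

End marginal.

Lemma bounded_integrable d (T : measurableType d) (R : realType)
    (P : probability T R) (f : T -> R) :
  measurable_fun setT f -> bounded_fun f -> P.-integrable setT (EFin \o f).
Proof.
move=> mf bf; apply: measurable_bounded_integrable => //.
by apply: le_lt_trans (probability_le1 P measurableT) _; rewrite ltry.
Qed.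

(** Witnesses that couplings exist, which the case of a zero Lipschitz constant relies on. *)
Lemma coupling_prod (R : realType) d (T : measurableType d)
    (P Q : probability T R) : coupling P Q (P \x Q)%E.
Proof.
move=> X mX; rewrite /pushforward.
have -> : fst @^-1` X = X `*` [set: T] by apply/seteqP; split=> x //= [].
have -> : snd @^-1` X = [set: T] `*` X by apply/seteqP; split=> x //= [].
split; rewrite /= product_measure1E //.
  by rewrite -[RHS]mule1; congr (_ * _)%E; exact: probability_setT.
by rewrite -[RHS]mul1e; congr (_ * _)%E; exact: probability_setT.
Qed.

Lemma bounded_fun_comp (R : realType) (T T' : Type) (g : T -> T')
    (f : T' -> R) : bounded_fun f -> bounded_fun (f \o g).
Proof.
by case=> M [Mr fM]; exists M; split=> // y /fM fy x _; exact: fy.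
Qed.

Section transport.
Context (R : realType) (N : nat) (P Q : probability (N.-tuple R) R).
Context (f : N.-tuple R -> R) (C : R).
Context (mf : measurable_fun setT f) (bf : bounded_fun f) (C0 : 0 <= C).
Context (f_lip : forall x y, `|f x - f y| <= C * dist2 x y).

(** Over [g] the gap is the integral of [f p.1 - f p.2], whose absolute value is at most [C] times
    the distance. The transport cost may be [+oo], so the bound is stated in the extended reals. *)
Lemma coupling_gap g : coupling P Q g ->
  (`|\int[P]_x f x - \int[Q]_x f x|%:E
     <= C%:E * \int[g]_p (dist2 p.1 p.2)%:E)%E.
Proof.
move=> gPQ.
have gP X : measurable X -> pushforward g fst X = P X by move=> /gPQ[].
have gQ X : measurable X -> pushforward g snd X = Q X by move=> /gPQ[].
have iP := bounded_integrable P mf bf; have iQ := bounded_integrable Q mf bf.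
rewrite -(Rintegral_marginal (@measurable_fst _ _ _ _) gP iP).
rewrite -(Rintegral_marginal (@measurable_snd _ _ _ _) gQ iQ).
have i1 := integrable_marginal (@measurable_fst _ _ _ _) gP iP.
have i2 := integrable_marginal (@measurable_snd _ _ _ _) gQ iQ.
rewrite -RintegralB // EFin_normr_Rintegral //; last exact: integrableB i1 i2.
have mfg : measurable_fun setT (fun p : _ * _ => (f p.1 - f p.2)%:E).
  apply/measurable_EFinP; apply: measurable_funB.
  - by apply: measurableT_comp mf _; exact: measurable_fst.
  - by apply: measurableT_comp mf _; exact: measurable_snd.
apply: le_trans (le_abse_integral _ _ mfg) _ => //.
have mdist : measurable_fun setT
    (fun p : N.-tuple R * N.-tuple R => (dist2 p.1 p.2)%:E).
  by apply/measurable_EFinP; exact: measurable_dist2.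
rewrite -ge0_integralZl_EFin //; last by move=> p _; rewrite lee_fin sqrtr_ge0.
apply: ge0_le_integral => //.
- exact: measurableT_comp.
- exact: measurable_funeM.
- by move=> p _; rewrite lee_fin; exact: f_lip.
Qed.

Lemma W1_gap : (`|\int[P]_x f x - \int[Q]_x f x|%:E <= C%:E * W1 P Q)%E.
Proof.
move: C0; rewrite le_eqVlt => /predU1P[C_eq0|C_gt0].
  (* Here W1 P Q may be +oo, so the factor C cannot be divided out; but
     0 * +oo = 0 and one coupling already bounds the gap by 0. *)
  have := coupling_gap (coupling_prod P Q).
  by rewrite -C_eq0 !mul0e.
(* For [C > 0], dividing by [C] leaves a lower bound to be checked on the cost of each coupling
   separately. *)
rewrite -lee_pdivrMl //; apply: le_ereal_inf_tmp => _ [g gPQ <-].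
by rewrite lee_pdivrMl //; exact: coupling_gap.
Qed.

End transport.

(** Fubini for real-valued integrals. The integrability of the inner integral is recorded as well,
    since it is what permits subtracting two such iterated integrals under [p]. *)
Lemma Rintegral_prod d1 d2 (T1 : measurableType d1) (T2 : measurableType d2)
    (R : realType) (p : probability T1 R) (P : probability T2 R)
    (F : T1 * T2 -> R) :
  measurable_fun setT F -> bounded_fun F ->
  p.-integrable setT (EFin \o (fun a => \int[P]_x F (a, x))) /\
  \int[(p \x P)%E]_t F t = \int[p]_a \int[P]_x F (a, x).
Proof.
move=> mF bF.
have iF : (p \x P)%E.-integrable setT (EFin \o F) by exact: bounded_integrable.
(* Every section of [F] is bounded, so its integral is finite and [fine] does not replace an
   infinite value by 0. *)
have FE a : ((\int[P]_x F (a, x))%:E = fubini_F P (EFin \o F) a)%E.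
  rewrite /Rintegral fineK //; apply: integrable_fin_num => //.
  apply: (@bounded_integrable _ _ _ P (fun x => F (a, x))).
    exact: measurableT_comp.
  exact: (bounded_fun_comp (pair a) bF).
split.
  by rewrite (_ : EFin \o _ = fubini_F P (EFin \o F));
    [exact: integrable_fubini_F | apply/funext].
rewrite [LHS]/Rintegral -integral12_prod_meas1 //; congr fine.
by apply: eq_integral => a _; rewrite FE.
Qed.

Lemma W1_gap_prod (R : realType) (N : nat) dA (A : measurableType dA)
    (p : probability A R) (P Q : probability (N.-tuple R) R)
    (F : A * N.-tuple R -> R) (C : R) :
  measurable_fun setT F -> bounded_fun F -> 0 <= C ->
  (forall a x y, `|F (a, x) - F (a, y)| <= C * dist2 x y) ->
  (`|\int[(p \x P)%E]_t F t - \int[(p \x Q)%E]_t F t|%:E <= C%:E * W1 P Q)%E.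
Proof.
move=> mF bF C0 F_lip.
have [iP ->] := Rintegral_prod p P mF bF.
have [iQ ->] := Rintegral_prod p Q mF bF.
rewrite -RintegralB // EFin_normr_Rintegral //; last exact: integrableB iP iQ.
have mgap : measurable_fun setT
    (fun a => (\int[P]_x F (a, x) - \int[Q]_x F (a, x))%:E).
  by case/integrableP: (integrableB measurableT iP iQ).
apply: le_trans (le_abse_integral _ _ mgap) _ => //.
(* As [p] has mass 1, the bound is its own average over actions; this reduces the claim to a
   pointwise comparison in [a]. *)
have <- : (\int[p]_(a in setT) cst (C%:E * W1 P Q) a = C%:E * W1 P Q)%E.
  rewrite integral_cst // -[RHS]mule1; congr (_ * _)%E.
  exact: probability_setT.
apply: ge0_le_integral => //.
  exact: measurableT_comp.
move=> a _; apply: (@W1_gap _ _ P Q (fun x => F (a, x))) => //.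
  exact: measurableT_comp.
exact: (bounded_fun_comp (pair a) bF).
Qed.

Theorem proposition3p2 (R : realType) (N : nat)
  (Z : Type) (H : normedModType R)
  (dS : measure_display) (S : measurableType dS)
  (z : S -> Z) (h : S -> H)
  (zh_inj : forall s s' : S, z s = z s' -> h s = h s' -> s = s')
  (dA : measure_display) (A : measurableType dA)
  (Pi : A -> N.-tuple R) (mPi : measurable_fun setT Pi)
  (Upd : S -> N.-tuple R -> N.-tuple R -> S)
  (mUpd : measurable_fun setT
     (fun t : S * N.-tuple R * N.-tuple R => Upd t.1.1 t.1.2 t.2))
  (O D : Type) (Phi : O -> S) (Psi : O -> D)
  (sel : S -> O) (Phi_sel : forall s : S, Phi (sel s) = s)
  (Preal : S -> probability (N.-tuple R) R)
  (Pscen : D -> probability (N.-tuple R) R)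
  (r : S -> N.-tuple R -> N.-tuple R -> R)
  (delta : R) (delta_gt0 : 0 < delta) (delta_lt1 : delta < 1)
  (Lh : R) (Lh_ge0 : 0 <= Lh)
  (Upd_z : forall (s : S) (w x y : N.-tuple R),
     z (Upd s w x) = z (Upd s w y))
  (Upd_lip : forall (s : S) (w x y : N.-tuple R),
     `|h (Upd s w x) - h (Upd s w y)| <= Lh * dist2 x y)
  (pi : S -> probability A R)
  (r_int : forall s : S,
     (pi s \x Pscen (Psi (sel s)))%E.-integrable setT
       (fun t => (r s (Pi t.1) t.2)%:E))
  (J : S -> probability (A * N.-tuple R * N.-tuple R)%type R)
  (J_law : forall s : S, hyb_law (pi s) (Pscen (Psi (sel s))) (Preal s) (J s))
  (V : S -> R) (V_bounded : bounded_fun V) (mV : measurable_fun setT V)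
  (LV : R) (LV_ge0 : 0 <= LV)
  (V_lip : forall s s' : S, z s = z s' -> `|V s - V s'| <= LV * `|h s - h s'|) :
  (sup_norm (fun s => Thyb Pi Upd r delta J V s
                      - Tscen Psi sel Pscen Pi Upd r delta pi V s)%R
   <= (delta * LV * Lh)%:E * DeltaW Phi Psi Preal Pscen)%E.
Proof.
apply: ge_ereal_sup => _ [s _ <-].
pose F (t : A * N.-tuple R) := V (Upd s (Pi t.1) t.2).
have mUpd_arg : measurable_fun setT
    (fun t : A * N.-tuple R => (s, Pi t.1, t.2)).
  apply: measurable_fun_pair; last exact: measurable_snd.
  apply: measurable_fun_pair => //.
  by apply: measurableT_comp mPi _; exact: measurable_fst.
have mF : measurable_fun setT F.
  exact: measurableT_comp mV (measurableT_comp mUpd mUpd_arg).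
have bF : bounded_fun F by exact: bounded_fun_comp V_bounded.
(* [Upd_z] gives both successor states the same context, which is what [V_lip] asks for; [Upd_lip]
   then bounds the memory gap. *)
have F_lip a x y : `|F (a, x) - F (a, y)| <= LV * Lh * dist2 x y.
  apply: le_trans (V_lip _ _ (Upd_z _ _ _ _)) _.
  by rewrite -mulrA ler_wpM2l.
have [J1 J2] := J_law s.
have m11 : measurable_fun setT
    (fun t : A * N.-tuple R * N.-tuple R => (t.1.1, t.1.2)).
  apply: measurable_fun_pair.
    by apply: measurableT_comp measurable_fst measurable_fst.
  by apply: measurableT_comp measurable_snd measurable_fst.
have m12 : measurable_fun setT
    (fun t : A * N.-tuple R * N.-tuple R => (t.1.1, t.2)).
  apply: measurable_fun_pair measurable_snd.
  by apply: measurableT_comp measurable_fst measurable_fst.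
set Q := Pscen (Psi (sel s)) in J1 *; set P := Preal s in J2 *.
have iFP : (pi s \x P)%E.-integrable setT (EFin \o F)
  by exact: bounded_integrable.
have iFQ : (pi s \x Q)%E.-integrable setT (EFin \o F)
  by exact: bounded_integrable.
(* The reward is integrated through the first marginal of [J] and the continuation value through the
   second, so the reward term coincides with the one in [scen]. *)
have hyb : Thyb Pi Upd r delta J V s =
    \int[(pi s \x Q)%E]_t r s (Pi t.1) t.2 + delta * \int[(pi s \x P)%E]_t F t.
  rewrite -(Rintegral_marginal m11 J1 (r_int s)).
  rewrite -(Rintegral_marginal m12 J2 iFP).
  have iF := integrable_marginal m12 J2 iFP.
  rewrite -RintegralZl // -RintegralD //.
  - exact: (integrable_marginal m11 J1 (r_int s)).
  - exact: integrableZl iF.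
have scen : Tscen Psi sel Pscen Pi Upd r delta pi V s =
    \int[(pi s \x Q)%E]_t r s (Pi t.1) t.2 + delta * \int[(pi s \x Q)%E]_t F t.
  rewrite -RintegralZl // -RintegralD //.
  - exact: r_int.
  - exact: integrableZl iFQ.
rewrite hyb scen opprD addrACA subrr add0r -mulrBr normrM gtr0_norm //.
rewrite EFinM -mulrA EFinM -muleA; apply: lee_wpmul2l.
  by rewrite lee_fin ltW.
have C0 : 0 <= LV * Lh by rewrite mulr_ge0.
apply: le_trans (W1_gap_prod (pi s) P Q mF bF C0 F_lip) _.
rewrite lee_wpmul2l ?lee_fin //; apply: ereal_sup_ubound.
(* The information [sel s] indexes the relevant term of the supremum: its state is [s] and its
   descriptor is the one used by [Tscen] at [s]. *)
by exists (sel s) => //; rewrite Phi_sel.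
Qed.
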